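(* Let $n \geq 1$ and $N = 2^n$. There is a deterministic algorithm running in time polynomial in $N$ that, given any DeMorgan circuit $C$ on $n + N$ inputs of size $s < 2N + \log N - 2$ (purporting to compute $\mathrm{MUX}_n$), outputs an input $(\alpha, \rho)$ with $\alpha \in \{0,1\}^n$ and $\rho \in \{0,1\}^N$ such that $C(\alpha, \rho) \neq \mathrm{MUX}_n(\alpha, \rho)$.
   Context: A DeMorgan circuit is a Boolean circuit whose gates are binary AND gates, binary OR gates, and (unary) NOT gates. The size of a circuit is the number of its binary gates (NOT gates are not counted). The multiplexer $\mathrm{MUX}_n : \{0,1\}^n \times \{0,1\}^{2^n} \to \{0,1\}$ takes $n$ address bits $\vec a$ and $2^n$ data bits $\vec x = (x_1,\dots,x_{2^n})$ and outputs the data bit $x_{(\vec a)+1}$, where $(\vec a)$ denotes the integer whose base-2 representation is $\vec a$. Logarithms are base 2.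
   Formalization: The running time is bounded by a polynomial in N plus the number of NOT gates of C, not in N alone: NOT gates are not counted in s, so for n = 1 and C a long chain of NOTs on the address bit no time bound depending only on N is possible. *)

(* Defs.v *)
From mathcomp Require Import all_boot.

Set Implicit Arguments.
Unset Strict Implicit.
Unset Printing Implicit Defensive.

(** * DeMorgan circuits *)

(* A circuit on [m] inputs is a DAG listed in topological order.  Wires
   0, ..., m-1 carry the inputs and wire m + k carries the value of the k-th
   gate; gates have unbounded fan-out, and there are no constants. *)
Inductive gate : Type :=
| GNot of nat
| GAnd of nat & nat
| GOr of nat & nat.

Definition gate_wf (w : nat) (g : gate) : bool :=
  match g with
  | GNot i => i < w
  | GAnd i j | GOr i j => (i < w) && (j < w)
  end.

Fixpoint gates_wf (w : nat) (gs : seq gate) : bool :=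
  if gs is g :: gs' then gate_wf w g && gates_wf w.+1 gs' else true.

Record circuit (m : nat) : Type := Circuit {
  circ_gates : seq gate;
  circ_out : nat;
  circ_wf : gates_wf m circ_gates && (circ_out < m + size circ_gates)
}.

Definition is_not (g : gate) : bool := if g is GNot _ then true else false.

Definition circ_size m (C : circuit m) : nat :=
  count (predC is_not) (circ_gates C).

(* [circ_size] ignores NOT gates, so circuits of bounded size can have
   arbitrarily long descriptions, all of which may matter (e.g. the parity of a
   chain of NOT gates).  Running times are therefore measured in
   2 ^ n + circ_nots C, which is polynomial in N = 2 ^ n as soon as the number
   of NOT gates is, for instance with at most one NOT gate per input and per
   binary gate. *)
Definition circ_nots m (C : circuit m) : nat := count is_not (circ_gates C).

Definition gate_val (ws : seq bool) (g : gate) : bool :=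
  match g with
  | GNot i => ~~ nth false ws i
  | GAnd i j => nth false ws i && nth false ws j
  | GOr i j => nth false ws i || nth false ws j
  end.

Definition circ_eval m (C : circuit m) (x : m.-tuple bool) : bool :=
  nth false (foldl (fun ws g => rcons ws (gate_val ws g)) x (circ_gates C))
      (circ_out C).

(** * The multiplexer *)

(* Most significant bit first. *)
Definition addr (a : seq bool) : nat :=
  foldl (fun v (b : bool) => 2 * v + b) 0 a.

Lemma addr_lt n (a : n.-tuple bool) : addr a < 2 ^ n.
Proof.
have H : forall (s : seq bool) v, foldl (fun v (b : bool) => 2 * v + b) v s
  < v.+1 * 2 ^ size s.
  elim=> [|b s IHs] v /=; first by rewrite muln1.
  apply: leq_trans (IHs _) _; rewrite expnS mulnA leq_mul2r; apply/orP; right.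
  by rewrite [v.+1 * 2]mulSnr [v * 2]mulnC addn2 ltnS -[leqRHS]addn1 leq_add2l leq_b1.
by have := H a 0; rewrite mul1n size_tuple.
Qed.

(* Data bits are indexed from 0, hence no shift by one. *)
Definition MUX n (a : n.-tuple bool) (x : (2 ^ n).-tuple bool) : bool :=
  tnth x (Ordinal (addr_lt a)).

(** * Algorithms and running time *)

(* Algorithms are programs of a first-order call-by-value functional language
   over binary trees (pure LISP with a single atom, as in the languages WHILE
   and F of N. D. Jones, "Computability and Complexity from a Programming
   Perspective").  The only primitives are building a node and
   testing/destructing a tree, and each evaluation step costs one.  Each step
   takes constant time on a machine storing trees as shared, immutable
   pointer structures, so step counts are polynomially related to
   Turing-machine time. *)
Inductive tree : Type := Leaf | Node of tree & tree.

Inductive expr : Type :=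
| EVar of nat                    (* de Bruijn index *)
| ELeaf
| ENode of expr & expr
| EMatch of expr & expr & expr   (* the Node branch binds left = 0, right = 1 *)
| ELet of expr & expr
| ECall of nat & expr.

(* A program is a finite list of mutually recursive unary functions, given by
   their bodies; the argument is variable 0 and the entry point is function 0. *)
Definition program : Type := seq expr.

(* [evals P env e v t]: under [P] and [env], [e] evaluates to [v] in [t] steps. *)
Inductive evals (P : program) : seq tree -> expr -> tree -> nat -> Prop :=
| ev_var env i : evals P env (EVar i) (nth Leaf env i) 1
| ev_leaf env : evals P env ELeaf Leaf 1
| ev_node env e1 e2 v1 v2 t1 t2 :
    evals P env e1 v1 t1 -> evals P env e2 v2 t2 ->
    evals P env (ENode e1 e2) (Node v1 v2) (t1 + t2).+1
| ev_match_leaf env e e0 e1 v t t' :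
    evals P env e Leaf t -> evals P env e0 v t' ->
    evals P env (EMatch e e0 e1) v (t + t').+1
| ev_match_node env e e0 e1 l r v t t' :
    evals P env e (Node l r) t -> evals P [:: l, r & env] e1 v t' ->
    evals P env (EMatch e e0 e1) v (t + t').+1
| ev_let env e1 e2 v1 v t1 t2 :
    evals P env e1 v1 t1 -> evals P (v1 :: env) e2 v t2 ->
    evals P env (ELet e1 e2) v (t1 + t2).+1
| ev_call env f e v w t t' :
    evals P env e v t -> evals P [:: v] (nth ELeaf P f) w t' ->
    evals P env (ECall f e) w (t + t').+1.

Definition runs (P : program) (x y : tree) (t : nat) : Prop :=
  evals P [:: x] (nth ELeaf P 0) y t.

Lemma evals_det P env e v t v' t' :
  evals P env e v t -> evals P env e v' t' -> v = v' /\ t = t'.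
Proof.
move=> H; elim: H v' t' => {env e v t}; intros;
  match goal with H : evals _ _ _ ?v' ?t' |- _ = ?v' /\ _ = ?t' =>
    inversion H; subst; clear H end => //;
  repeat match goal with
  | IH : forall v' t', evals P ?env ?e v' t' -> _, H : evals P ?env ?e _ _ |- _ =>
      let E := fresh "E" in
      have [E ?] := IH _ _ H; clear H; try discriminate E;
      try (injection E as ? ?); subst
  end; by [].
Qed.

(* Wire numbers are encoded in unary: they are smaller than the total number
   of inputs and gates, so this changes input lengths only polynomially. *)
Definition enc_nat (k : nat) : tree := iter k (Node Leaf) Leaf.

Definition enc_bool (b : bool) : tree := if b then Node Leaf Leaf else Leaf.

Definition enc_seq T (enc : T -> tree) (s : seq T) : tree :=
  foldr (fun x acc => Node (enc x) acc) Leaf s.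

Definition enc_gate (g : gate) : tree :=
  match g with
  | GNot i => Node (enc_nat 0) (enc_nat i)
  | GAnd i j => Node (enc_nat 1) (Node (enc_nat i) (enc_nat j))
  | GOr i j => Node (enc_nat 2) (Node (enc_nat i) (enc_nat j))
  end.

Definition enc_circuit m (C : circuit m) : tree :=
  Node (enc_seq enc_gate (circ_gates C)) (enc_nat (circ_out C)).

Definition enc_instance n (C : circuit (n + 2 ^ n)) : tree :=
  Node (enc_nat n) (enc_circuit C).

Definition enc_input n (a : n.-tuple bool) (x : (2 ^ n).-tuple bool) : tree :=
  Node (enc_seq enc_bool a) (enc_seq enc_bool x).

(* Main.v *)
Require Import Defs.
From mathcomp Require Import all_boot zify.

(* Gate elimination.  Restrict the data bits one at a time, in the order of
   their addresses.  If C is correct on the few inputs that are tested, then at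
   stage i the restricted circuit is sensitive to x_i at an input with address
   i; follow a path of sensitive wires from x_i to the output and fix x_i to
   the value that makes the first live gate on it constant (live: neither
   operand is constant under the restriction).  As the restricted circuit still
   depends on x_(i+1), the output is not constant, so the next live gate on the
   path dies too, and every stage but the last kills two gates.  With a single
   data bit left, the circuit is still sensitive to all n address bits, and
   fixing them one after the other to 1 kills a gate each.  Hence
   2 (N - 1) + n <= size, unless one of the tested inputs is a counterexample.

   The constant fixing x_i is found by one evaluation of C over a ten-element
   algebra ([wval]), and Boolean evaluation is a special case of it, so that the
   program needs a single circuit evaluator. *)

Set Implicit Arguments.
Unset Strict Implicit.
Unset Printing Implicit Defensive.

(** * Evaluation of circuits over an arbitrary gate algebra *)

Definition gen_gate (T : Type) (d : T) (fn : T -> T) (fa fo : T -> T -> T)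
    (ws : seq T) (g : gate) : T :=
  match g with
  | GNot i => fn (nth d ws i)
  | GAnd i j => fa (nth d ws i) (nth d ws j)
  | GOr i j => fo (nth d ws i) (nth d ws j)
  end.

Definition gen_eval (T : Type) (d : T) (fn : T -> T) (fa fo : T -> T -> T)
    (ws : seq T) (gs : seq gate) : seq T :=
  foldl (fun ws g => rcons ws (gen_gate d fn fa fo ws g)) ws gs.

Lemma nth_map_dflt (T U : Type) (f : T -> U) d s i :
  nth (f d) (map f s) i = f (nth d s i).
Proof. by elim: s i => [|x s IHs] [|i] //=. Qed.

(** A homomorphism of gate algebras commutes with evaluation. All links between Boolean,
    three-valued and [wval] evaluation are instances. *)
Lemma gen_eval_map (T U : Type) (f : T -> U) d fn fa fo fn' fa' fo' ws gs :
  (forall x, f (fn x) = fn' (f x)) ->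
  (forall x y, f (fa x y) = fa' (f x) (f y)) ->
  (forall x y, f (fo x y) = fo' (f x) (f y)) ->
  map f (gen_eval d fn fa fo ws gs) = gen_eval (f d) fn' fa' fo' (map f ws) gs.
Proof.
move=> Hn Ha Ho; elim: gs ws => [|g gs IHgs] ws //=.
rewrite /gen_eval /= -/(gen_eval _ _ _ _ _ _) IHgs map_rcons; congr gen_eval.
by congr rcons; case: g => [i|i j|i j] /=; rewrite !nth_map_dflt.
Qed.

Definition beval := gen_eval false negb andb orb.

Definition bout (gs : seq gate) (o : nat) (x : seq bool) : bool :=
  nth false (beval x gs) o.

Lemma circ_evalE m (C : circuit m) (x : m.-tuple bool) :
  circ_eval C x = bout (circ_gates C) (circ_out C) x.
Proof.
by [].
Qed.

(** * Partially evaluated circuits *)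

Definition tnot (x : option bool) : option bool := omap negb x.

(** Kleene's strong conjunction. [None] means that constant propagation does not determine the
    wire. *)
Definition tand (x y : option bool) : option bool :=
  match x, y with
  | Some false, _ | _, Some false => Some false
  | Some true, z | z, Some true => z
  | None, None => None
  end.

Definition tor (x y : option bool) : option bool := tnot (tand (tnot x) (tnot y)).

Definition tgate := gen_gate None tnot tand tor.

Definition teval := gen_eval None tnot tand tor.

Definition live (ts : seq (option bool)) (g : gate) : bool :=
  match g with
  | GNot _ => false
  | GAnd i j | GOr i j => ~~ nth None ts i && ~~ nth None ts j
  end.

Fixpoint nlive (ts : seq (option bool)) (gs : seq gate) : nat :=
  if gs is g :: gs' then live ts g + nlive (rcons ts (tgate ts g)) gs' else 0.

Lemma nlive_size ts gs : nlive ts gs <= count (predC is_not) gs.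
Proof.
elim: gs ts => [|g gs IHgs] ts //=.
by apply: leq_add (IHgs _); case: g => //= i j; rewrite leq_b1.
Qed.

(* The value of a wire under a restriction that leaves a distinguished variable
   x free, together with its values at two points p0, p1 that differ only in x
   (x = 0 at p0, x = 1 at p1).  [Con b]: constant under the restriction;
   [Same b]: not constant, but equal to b at both points; [Diff v o]: v at p0
   and ~~ v at p1, and then a path of wires sensitive to x leads to this wire;
   o is [None] if no live gate lies on it, i.e. the wire is a literal of x, and
   [Some c] if x = c forces the first live gate on it to a constant. *)
Inductive wval := Con of bool | Same of bool | Diff of bool & option bool.

Definition wnot (x : wval) : wval :=
  match x with
  | Con b => Con (~~ b)
  | Same b => Same (~~ b)
  | Diff v o => Diff (~~ v) o
  end.

(** A literal equal to [v] at x = 0 is false at x = [v], so this value of x kills a conjunction that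
    the literal enters. A value recorded by an earlier live gate is kept. *)
Definition mark (v : bool) (o : option bool) : option bool :=
  if o is Some c then Some c else Some v.

(** If both operands are sensitive and agree, the path is continued through the left one; if they
    disagree, the conjunction is false at both points. *)
Definition wand (x y : wval) : wval :=
  match x, y with
  | Con false, _ | _, Con false => Con false
  | Con true, z | z, Con true => z
  | Same a, Same b => Same (a && b)
  | Same a, Diff v o | Diff v o, Same a =>
      if a then Diff v (mark v o) else Same false
  | Diff v o, Diff v' _ => if v == v' then Diff v (mark v o) else Same false
  end.

Definition wor (x y : wval) : wval := wnot (wand (wnot x) (wnot y)).

(** The default [Same false] is mapped by [at0], [at1] and [con] to the defaults of the Boolean and
    three-valued evaluations. *)
Definition wgate := gen_gate (Same false) wnot wand wor.

Definition weval := gen_eval (Same false) wnot wand wor.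

Definition wout (gs : seq gate) (o : nat) (x : seq wval) : wval :=
  nth (Same false) (weval x gs) o.

Definition at0 (x : wval) : bool :=
  match x with Con b | Same b | Diff b _ => b end.

Definition at1 (x : wval) : bool :=
  match x with Con b | Same b => b | Diff v _ => ~~ v end.

Definition con (x : wval) : option bool := if x is Con b then Some b else None.

Definition is_diff (x : wval) : bool := if x is Diff _ _ then true else false.

Lemma at0_wout gs o x : at0 (wout gs o x) = bout gs o (map at0 x).
Proof.
rewrite /wout -nth_map_dflt /weval (@gen_eval_map _ _ _ _ _ _ _ negb andb orb) //.
- by case.
- by do 2![case=> [[]|[]|[] [[]|]]].
- by do 2![case=> [[]|[]|[] [[]|]]].
Qed.

Lemma at1_wout gs o x : at1 (wout gs o x) = bout gs o (map at1 x).
Proof.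
rewrite /wout -nth_map_dflt /weval (@gen_eval_map _ _ _ _ _ _ _ negb andb orb) //.
- by case.
- by do 2![case=> [[]|[]|[] [[]|]]].
- by do 2![case=> [[]|[]|[] [[]|]]].
Qed.

Lemma con_weval x gs : map con (weval x gs) = teval (map con x) gs.
Proof.
rewrite /weval (@gen_eval_map _ _ _ _ _ _ _ tnot tand tor) //.
- by case.
- by do 2![case=> [[]|[]|[] [[]|]]].
- by do 2![case=> [[]|[]|[] [[]|]]].
Qed.

Lemma nth_con s i : nth None (map con s) i = con (nth (Same false) s i).
Proof. exact: (nth_map_dflt con (Same false)). Qed.

Lemma con_wout gs o x : con (wout gs o x) = nth None (teval (map con x) gs) o.
Proof. by rewrite -con_weval nth_con. Qed.

Lemma wout_same gs o x : wout gs o (map Same x) = Same (bout gs o x).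
Proof.
rewrite /bout -nth_map_dflt /beval.
by rewrite (@gen_eval_map _ _ Same _ _ _ _ wnot wand wor) //; case; case.
Qed.

Lemma is_diff_wout gs o x :
  bout gs o (map at0 x) != bout gs o (map at1 x) -> is_diff (wout gs o x).
Proof. by rewrite -at0_wout -at1_wout; case: (wout _ _ _) => //= b; rewrite eqxx. Qed.

(* [x] is the value of a wire, [t] its constant, if any, once the distinguished
   variable is set to [c], and [d] a lower bound on the number of gates that
   this has killed so far. *)
Definition fixed_rel (c : bool) (d : nat) (x : wval) (t : option bool) : bool :=
  match x with
  | Con b => t == Some b
  | Same _ => true
  | Diff v None => t == Some (v (+) c)
  | Diff _ (Some e) => if e == c then (t && (0 < d)) || (1 < d) else t || (0 < d)
  end.

Lemma fixed_rel_mono c d d' x t :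
  d <= d' -> fixed_rel c d x t -> fixed_rel c d' x t.
Proof.
move=> le_d; case: x => //= v [e|] //; case: eqP => _; case: t => [t|] /=; try lia.
Qed.

Lemma fixed_rel_live c d x t : fixed_rel c d x t -> ~~ t -> ~~ con x.
Proof. by case: t => [t|] //; case: x. Qed.

Lemma fixed_rel_not c d x t :
  fixed_rel c d x t -> fixed_rel c d (wnot x) (tnot t).
Proof. by case: x => [[]|[]|[] [[]|]]; case: t => [[]|]; case: c. Qed.

(** The amount added to [d] is 1 exactly when the gate was live and the fixing kills it. As
    [fixed_rel] only compares [d] with 0 and 1, the cases 0, 1 and at least 2 leave a finite
    check. *)
Lemma fixed_rel_and c d x y t u :
  fixed_rel c d x t -> fixed_rel c d y u ->
  fixed_rel c (d + (~~ con x && ~~ con y && ~~ (~~ t && ~~ u)))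
    (wand x y) (tand t u).
Proof.
case: d => [|[|d]]; case: c; case: x => [[]|[]|[] [[]|]]; case: t => [[]|] //;
by case: y => [[]|[]|[] [[]|]]; case: u => [[]|].
Qed.

Lemma con_wnot x : isSome (con (wnot x)) = isSome (con x).
Proof. by case: x. Qed.

Lemma isSome_tnot t : isSome (tnot t) = isSome t.
Proof. by case: t. Qed.

Lemma fixed_rel_or c d x y t u :
  fixed_rel c d x t -> fixed_rel c d y u ->
  fixed_rel c (d + (~~ con x && ~~ con y && ~~ (~~ t && ~~ u)))
    (wor x y) (tor t u).
Proof.
move=> /fixed_rel_not Hx /fixed_rel_not Hy; apply: fixed_rel_not.
by have := fixed_rel_and Hx Hy; rewrite !con_wnot !isSome_tnot.
Qed.

(** [a], [b] say whether the operands are constant before the fixing, [a'], [b'] after it. Constants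
    stay constant, so a gate live before is either live after or counted as killed. *)
Lemma dead_count (a b a' b' : bool) d :
  (~~ a' -> ~~ a) -> (~~ b' -> ~~ b) ->
  ~~ a && ~~ b + d =
    ~~ a' && ~~ b' + (d + (~~ a && ~~ b && ~~ (~~ a' && ~~ b'))).
Proof.
by case: a a' b b' => [] [] [] [] Ha Hb /=; try lia;
  first [have := Ha isT | have := Hb isT].
Qed.

Lemma fixed_rel_gate c d ws ts g :
  (forall i, fixed_rel c d (nth (Same false) ws i) (nth None ts i)) ->
  exists d', [/\ d <= d', live (map con ws) g + d = live ts g + d'
    & fixed_rel c d' (wgate ws g) (tgate ts g)].
Proof.
move=> H; case: g => [i|i j|i j] /=.
- by exists d; rewrite leqnn; split => //; apply: fixed_rel_not.
- rewrite !nth_con.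
  exists (d + (~~ con (nth (Same false) ws i) && ~~ con (nth (Same false) ws j)
     && ~~ (~~ nth None ts i && ~~ nth None ts j))).
  split; [exact: leq_addr| |exact: fixed_rel_and].
  by apply: dead_count; apply: fixed_rel_live.
- rewrite !nth_con.
  exists (d + (~~ con (nth (Same false) ws i) && ~~ con (nth (Same false) ws j)
     && ~~ (~~ nth None ts i && ~~ nth None ts j))).
  split; [exact: leq_addr| |exact: fixed_rel_or].
  by apply: dead_count; apply: fixed_rel_live.
Qed.

(** Summed over the circuit, [d' - d] is exactly the number of gates killed. *)
Lemma fixed_rel_eval c d ws ts gs :
  size ws = size ts ->
  (forall i, fixed_rel c d (nth (Same false) ws i) (nth None ts i)) ->
  exists d', [/\ nlive (map con ws) gs + d = nlive ts gs + d'
    & forall i, fixed_rel c d' (nth (Same false) (weval ws gs) i)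
                               (nth None (teval ts gs) i)].
Proof.
elim: gs d ws ts => [|g gs IHgs] d ws ts Hs H; first by exists d.
have [d1 [le_d Hl Hg]] := fixed_rel_gate g H.
have Hcon : tgate (map con ws) g = con (wgate ws g).
  have := con_weval ws [:: g]; rewrite /weval /teval /gen_eval /= map_rcons.
  by move/rcons_inj=> [].
have [|i|d' [Hd' Hall]] := IHgs d1 (rcons ws (wgate ws g)) (rcons ts (tgate ts g)).
- by rewrite !size_rcons Hs.
- rewrite !nth_rcons Hs; case: ltnP => _; first exact: fixed_rel_mono (H i).
  by case: eqP.
exists d'; split; last exact: Hall.
rewrite /= Hcon; move: Hd'; rewrite map_rcons; lia.
Qed.

Definition forcing (x : wval) : bool := if x is Diff _ (Some c) then c else false.

(** Either value of x makes an operand of the first live gate on the path constant, which kills that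
    gate. The forcing value makes the gate itself constant, and since the output is not constant, a
    second gate must die. A path without live gates would make the output constant. *)
Lemma nlive_step gs o l r c (ts : seq (option bool)) :
  let x := wout gs o (l ++ Diff false None :: r) in
  all (predC is_diff) (l ++ r) ->
  ts = map con (l ++ Con c :: r) ->
  is_diff x -> nth None (teval ts gs) o = None ->
  nlive ts gs + (if c == forcing x then 2 else 1) <=
    nlive (map con (l ++ Diff false None :: r)) gs.
Proof.
move=> x Hall -> Hx Hout.
have [||d' [Hd Hr]] := @fixed_rel_eval c 0 (l ++ Diff false None :: r)
  (map con (l ++ Con c :: r)) gs.
- by rewrite size_map !size_cat.
- move: Hall; rewrite all_cat => /andP[Hl Hr] i.
  have HS y j : fixed_rel c 0 (Same false) y by [].
  have Hlr s j : all (predC is_diff) s ->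
      fixed_rel c 0 (nth (Same false) s j) (nth None (map con s) j).
    move=> Hs; rewrite nth_con.
    case: (ltnP j (size s)) => Hj; last by rewrite nth_default.
    by move/all_nthP: Hs => /(_ (Same false) j Hj); case: nth => //=.
  rewrite map_cat !nth_cat size_map; case: ltnP => _; first exact: Hlr.
  case: (i - size l) => [|j] /=; last exact: Hlr.
  by rewrite eqxx.
rewrite addn0 in Hd; rewrite Hd leq_add2l.
have := Hr o; rewrite Hout -/(wout gs o _) -/x.
case: x Hx => //= v [e|] // _; rewrite eq_sym.
by case: ifP.
Qed.

(** * The refutation procedure *)

(** Listed by increasing address, so that positions in the list are addresses. *)
Fixpoint allbits (n : nat) : seq (seq bool) :=
  if n is n'.+1 then
    map (cons false) (allbits n') ++ map (cons true) (allbits n')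
  else [:: [::]].

Lemma size_allbits n : size (allbits n) = 2 ^ n.
Proof. by elim: n => //= n IHn; rewrite size_cat !size_map IHn expnS; lia. Qed.

Lemma addr_cons b s : addr (b :: s) = b * 2 ^ size s + addr s.
Proof.
have H : forall (t : seq bool) v, foldl (fun v (b : bool) => 2 * v + b) v t
    = v * 2 ^ size t + addr t.
  rewrite /addr; elim=> [|c t IHt] v /=; first by rewrite muln1 addn0.
  rewrite (IHt (2 * v + c)) (IHt (2 * 0 + c)) expnS muln0 add0n mulnDl -addnA.
  by rewrite [v * _]mulnCA mulnA.
by rewrite {1}/addr /= H muln0 add0n.
Qed.

Lemma addr_lt_size a : addr a < 2 ^ size a.
Proof. exact: (addr_lt (in_tuple a)). Qed.

Lemma nth_allbits_addr a : nth [::] (allbits (size a)) (addr a) = a.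
Proof.
elim: a => [|b a IHa] //; rewrite addr_cons nth_cat size_map size_allbits.
have Ha := addr_lt_size a.
case: b => /=; rewrite ?mul1n ?mul0n ?add0n.
  by rewrite ltnNge leq_addr /= addKn (nth_map [::]) ?size_allbits // IHa.
by rewrite Ha (nth_map [::]) ?size_allbits // IHa.
Qed.

Lemma nth_allbits n k : k < 2 ^ n ->
  size (nth [::] (allbits n) k) = n /\ addr (nth [::] (allbits n) k) = k.
Proof.
elim: n k => [|n IHn] k; first by case: k.
rewrite expnS /= nth_cat size_map size_allbits => Hk.
case: ltnP => Hn.
  rewrite (nth_map [::]) ?size_allbits // addr_cons /=.
  by have [-> ->] := IHn _ Hn.
have Hk' : k - 2 ^ n < 2 ^ n by lia.
rewrite (nth_map [::]) ?size_allbits // addr_cons /=.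
by have [-> ->] := IHn _ Hk'; split=> //; lia.
Qed.

(** * Probes and the search for a counterexample *)

(** [ds] holds the expected outputs and is consumed in step with the addresses. It is [d] itself in
    every call from [refute], so no indexing is required. *)
Fixpoint check (gs : seq gate) (o : nat) (d : seq bool)
    (addrs : seq (seq bool)) (ds : seq bool) : option (seq bool * seq bool) :=
  match addrs, ds with
  | a :: addrs', x :: ds' =>
      if bout gs o (a ++ d) == x then check gs o d addrs' ds' else Some (a, d)
  | _, _ => None
  end.

Lemma check_Some gs o d addrs ds a x :
  check gs o d addrs ds = Some (a, x) ->
  x = d /\ exists k, [/\ k < size addrs, a = nth [::] addrs k
                       & bout gs o (a ++ x) <> nth false ds k].
Proof.
elim: addrs ds => [|a' addrs IH] [|b ds] //=; case: eqP => [_ /IH|Hb [<- <-]].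
  by move=> [-> [k [Hk -> H]]]; split=> //; exists k.+1.
by split=> //; exists 0.
Qed.

Lemma check_None gs o d addrs ds k :
  check gs o d addrs ds = None -> k < size addrs -> k < size ds ->
  bout gs o (nth [::] addrs k ++ d) = nth false ds k.
Proof.
elim: addrs ds k => [|a addrs IH] [|b ds] [|k] //=; case: eqP => //= _.
exact: IH.
Qed.

Definition probe (cs : seq bool) (b : bool) (m : nat) : seq bool :=
  cs ++ b :: nseq m false.

(** Superposes the two probes of a stage: [at0] and [at1] recover them, while only the bits [cs]
    count as constants. *)
Definition stage (a cs : seq bool) (m : nat) : seq wval :=
  map Same a ++ map Con cs ++ Diff false None :: map Same (nseq m false).

(** Each probe is tested at all addresses: the current one gives sensitivity to the current data
    bit, the others serve to fix the address bits at the last stage. *)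
Fixpoint refute (gs : seq gate) (o : nat) (addrs rest : seq (seq bool))
    (cs : seq bool) : option (seq bool * seq bool) :=
  if rest is a :: rest' then
    let m := size rest' in
    if check gs o (probe cs false m) addrs (probe cs false m) is Some r
    then Some r
    else if check gs o (probe cs true m) addrs (probe cs true m) is Some r
    then Some r
    else refute gs o addrs rest' (rcons cs (forcing (wout gs o (stage a cs m))))
  else None.

Lemma size_probe cs b m : size (probe cs b m) = size cs + m.+1.
Proof. by rewrite size_cat /= size_nseq. Qed.

Lemma refute_Some n gs o rest cs a x :
  refute gs o (allbits n) rest cs = Some (a, x) ->
  size cs + size rest = 2 ^ n ->
  [/\ size a = n, size x = 2 ^ n & bout gs o (a ++ x) <> nth false x (addr a)].
Proof.
have Hcheck d : size d = 2 ^ n -> check gs o d (allbits n) d = Some (a, x) ->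
    [/\ size a = n, size x = 2 ^ n & bout gs o (a ++ x) <> nth false x (addr a)].
  move=> Hd /check_Some[-> [k [Hk -> H]]]; rewrite size_allbits in Hk.
  by have [Hs Ha] := nth_allbits Hk; rewrite Ha.
elim: rest cs => [|a' rest IH] cs //=.
case E0: check => [r|].
  by case=> Er Hs; apply: Hcheck (etrans E0 (congr1 _ Er)); rewrite size_probe.
case E1: check => [r|].
  by case=> Er Hs; apply: Hcheck (etrans E1 (congr1 _ Er)); rewrite size_probe.
by move=> /IH H Hs; apply: H; rewrite size_rcons; lia.
Qed.

(** * Gates killed by the data bits *)

Definition good n gs o cs := forall b a, size a = n ->
  bout gs o (a ++ probe cs b (2 ^ n - size cs).-1) =
    nth false (probe cs b (2 ^ n - size cs).-1) (addr a).

Lemma refute_good n gs o a rest cs :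
  refute gs o (allbits n) (a :: rest) cs = None ->
  size cs + (size rest).+1 = 2 ^ n -> good n gs o cs.
Proof.
move=> /= H Hs b a' Ha'; have -> : (2 ^ n - size cs).-1 = size rest by lia.
have Hlt : addr a' < 2 ^ n by rewrite -Ha' addr_lt_size.
suff Hc : check gs o (probe cs b (size rest)) (allbits n) (probe cs b (size rest)) = None.
  have := check_None Hc; rewrite size_allbits size_probe Hs => /(_ _ Hlt Hlt).
  by rewrite -[in nth [::] _ _]Ha' nth_allbits_addr.
by case: b; move: H; case: check => // ; case: check.
Qed.

Definition data_pattern n (cs : seq bool) : seq (option bool) :=
  nseq n None ++ map Some cs ++ nseq (2 ^ n - size cs) None.

Lemma map_nseq (T U : Type) (f : T -> U) k x : map f (nseq k x) = nseq k (f x).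
Proof. by elim: k => //= k ->. Qed.

Lemma map_comp_eq (T U V : Type) (f : U -> V) (g : T -> U) h s :
  f \o g =1 h -> map f (map g s) = map h s.
Proof. by move=> H; rewrite -map_comp; apply: eq_map. Qed.

Lemma map_con_same s : map con (map Same s) = nseq (size s) None.
Proof. by elim: s => //= b s ->. Qed.

Lemma map_con_con s : map con (map Con s) = map Some s.
Proof. by rewrite -map_comp. Qed.

Lemma map_con_stage n a cs : size a = n -> size cs < 2 ^ n ->
  map con (stage a cs (2 ^ n - size cs).-1) = data_pattern n cs.
Proof.
move=> Ha Hc; rewrite /stage /data_pattern !map_cat /= !map_con_same map_con_con Ha.
rewrite size_nseq; congr (_ ++ (_ ++ _)).
by rewrite -subn_gt0 in Hc; case: (2 ^ n - size cs) Hc.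
Qed.

(** At the address of the current data bit, a correct output is [false] on one probe and [true] on
    the other. *)
Lemma stage_diff n gs o a cs : size a = n -> addr a = size cs ->
  good n gs o cs -> is_diff (wout gs o (stage a cs (2 ^ n - size cs).-1)).
Proof.
move=> Ha Hac Hg; apply: is_diff_wout.
have H0 : map at0 (stage a cs (2 ^ n - size cs).-1)
    = a ++ probe cs false (2 ^ n - size cs).-1.
  by rewrite /stage !map_cat /= !(@map_comp_eq _ _ _ _ _ id) // !map_id.
have H1 : map at1 (stage a cs (2 ^ n - size cs).-1)
    = a ++ probe cs true (2 ^ n - size cs).-1.
  by rewrite /stage !map_cat /= !(@map_comp_eq _ _ _ _ _ id) // !map_id.
by rewrite H0 H1 !Hg // Hac /probe !nth_cat ltnn subnn.
Qed.

Lemma all_not_diff_same s : all (predC is_diff) (map Same s).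
Proof. by elim: s. Qed.

Lemma all_not_diff_con s : all (predC is_diff) (map Con s).
Proof. by elim: s. Qed.

Lemma nlive_data_step n gs o a cs :
  let c := forcing (wout gs o (stage a cs (2 ^ n - size cs).-1)) in
  size a = n -> addr a = size cs -> (size cs).+1 < 2 ^ n ->
  good n gs o cs -> good n gs o (rcons cs c) ->
  nlive (data_pattern n (rcons cs c)) gs + 2 <= nlive (data_pattern n cs) gs.
Proof.
move=> c Ha Hac Hlt Hg Hg'.
have Hx := stage_diff Ha Hac Hg.
have [Ha' Hac'] := nth_allbits Hlt.
(* Correctness at the next stage makes the output sensitive to the next data bit, hence not constant
   after the fixing. *)
have Hx' := stage_diff Ha' (etrans Hac' (esym (size_rcons cs c))) Hg'.
have := @nlive_step gs o (map Same a ++ map Con cs)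
  (map Same (nseq (2 ^ n - size cs).-1 false)) c (data_pattern n (rcons cs c)).
cbv zeta; rewrite -!catA -/(stage a cs (2 ^ n - size cs).-1) -/c eqxx.
rewrite map_con_stage //; last by lia.
apply => //.
- by rewrite !all_cat !all_not_diff_same all_not_diff_con.
- rewrite /data_pattern !map_cat /= map_rcons -!cats1 -!catA /=.
  rewrite !map_con_same map_con_con Ha size_nseq size_cat addn1.
  congr (_ ++ (_ ++ _ :: _)).
  by congr nseq; lia.
- rewrite -(map_con_stage Ha') ?size_rcons // -con_wout.
  by move: Hx'; rewrite size_rcons; case: (wout _ _ _).
Qed.

(** * Gates killed by the address bits *)

(** Address bits are fixed to 1 because the address 1...1 selects the last data bit, the only one
    still free. *)
Definition addr_pattern n k (cs : seq bool) : seq (option bool) :=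
  nseq k (Some true) ++ nseq (n - k) None ++ map Some cs ++ [:: None].

Lemma addr_ones n : addr (nseq n true) = (2 ^ n).-1.
Proof.
elim: n => // n IHn; rewrite /= addr_cons IHn.
by rewrite size_nseq expnS; have := expn_gt0 2 n; lia.
Qed.

(** The address 1...1 and the address [a] with a single 0 at position [k] select the free data bit
    and a fixed one. A suitable value of the free bit makes the output sensitive to address bit
    [k]. *)
Lemma nlive_addr_step n gs o cs k :
  k < n -> size cs = (2 ^ n).-1 -> good n gs o cs ->
  nlive (addr_pattern n k.+1 cs) gs + 1 <= nlive (addr_pattern n k cs) gs.
Proof.
move=> Hk Hcs Hg; have Hpos : 0 < 2 ^ n by rewrite expn_gt0.
have Em : (2 ^ n - size cs).-1 = 0 by lia.
have Eones : nseq k true ++ true :: nseq (n - k.+1) true = nseq n true.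
  by rewrite -[true :: _]/(nseq (n - k.+1).+1 true) -nseqD; congr nseq; lia.
have Hones b : bout gs o (nseq n true ++ cs ++ [:: b]) = b.
  have := Hg b _ (size_nseq n true); rewrite Em addr_ones /probe /= => ->.
  by rewrite nth_cat Hcs ltnn subnn.
pose a := nseq k true ++ false :: nseq (n - k.+1) true.
have Ha : size a = n by rewrite size_cat /= !size_nseq; lia.
have Hadd : addr a < (2 ^ n).-1.
  have := addr_lt_size a; rewrite Ha => Hlt.
  suff : addr a != (2 ^ n).-1 by lia.
  rewrite -addr_ones; apply/eqP => E.
  have := nth_allbits_addr a; have := nth_allbits_addr (nseq n true).
  rewrite size_nseq Ha E => -> /(congr1 (fun s => nth true s k)).
  by rewrite nth_nseq Hk nth_cat size_nseq ltnn subnn.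
(* The opposite of the fixed bit selected by [a], so that the outputs at [a] and at 1...1 differ. *)
pose v := ~~ nth false cs (addr a).
have Hva : bout gs o (a ++ cs ++ [:: v]) = ~~ v.
  by rewrite -[RHS]/(~~ ~~ _) negbK; have := Hg v _ Ha;
     rewrite Em /probe /= => ->; rewrite nth_cat Hcs Hadd.
have := @nlive_step gs o (nseq k (Con true))
  (nseq (n - k.+1) (Same true) ++ map Con cs ++ [:: Same v]) true
  (addr_pattern n k.+1 cs).
set x := _ ++ _ :: _ => H.
have Ex : map con x = addr_pattern n k cs.
  rewrite /x /addr_pattern !map_cat /= !map_cat /= !map_nseq /=.
  rewrite -map_comp; congr (_ ++ _).
  by have -> : n - k = (n - k.+1).+1 by lia.
(* The imposed value [true] may differ from the forcing one, so only one gate is claimed. *)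
rewrite {}Ex in H; suff : nlive (addr_pattern n k.+1 cs) gs +
    (if true == forcing (wout gs o x) then 2 else 1) <=
    nlive (addr_pattern n k cs) gs by case: ifP => _; lia.
apply: H.
- by rewrite !all_cat all_not_diff_con !all_nseq /= !orbT.
- rewrite !map_cat /= !map_cat /= !map_nseq /= -map_comp /addr_pattern.
  have -> : nseq k.+1 (Some true) = nseq k (Some true) ++ [:: Some true].
    by rewrite -addn1 nseqD.
  by rewrite -catA.
- apply: is_diff_wout; rewrite /x !map_cat /= !map_cat /= !map_nseq /=.
  rewrite !(@map_comp_eq _ _ _ _ _ id) // !map_id.
  rewrite -[false :: _ ++ _]/((false :: _) ++ _) -[true :: _ ++ _]/((true :: _) ++ _).
  rewrite !(catA (nseq k true)) -/a Eones Hva Hones; by case: (v).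
(* After the fixing the output is still not constant: at address 1...1 it equals the last data bit,
   now taken as the distinguished variable. *)
- pose y := nseq k.+1 (Con true) ++ nseq (n - k.+1) (Same true) ++
    map Con cs ++ [:: Diff false None].
  have -> : addr_pattern n k.+1 cs = map con y.
    by rewrite /y !map_cat /= !map_nseq -map_comp.
  rewrite -con_wout; suff: is_diff (wout gs o y) by case: wout.
  apply: is_diff_wout; rewrite /y !map_cat !map_nseq.
  rewrite !(@map_comp_eq _ _ _ _ _ id) // !map_id.
  by rewrite !(catA (nseq k.+1 _)) -nseqD subnKC // !Hones.
Qed.

Lemma nlive_addr n gs o cs :
  size cs = (2 ^ n).-1 -> good n gs o cs -> n <= nlive (data_pattern n cs) gs.
Proof.
move=> Hcs Hg.
(* [j] is the number of free address bits. At [j = n] the pattern is [data_pattern n cs], since one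
   data bit remains. *)
have H j : j <= n -> j <= nlive (addr_pattern n (n - j) cs) gs.
  elim: j => // j IHj Hj.
  have Hk : n - j.+1 < n by lia.
  have := nlive_addr_step Hk Hcs Hg.
  rewrite (_ : (n - j.+1).+1 = n - j); last by lia.
  by have := IHj (ltnW Hj); lia.
have := H n (leqnn n); rewrite subnn /addr_pattern subn0 /data_pattern.
have -> // : 2 ^ n - size cs = 1.
by have := expn_gt0 2 n; lia.
Qed.

(** * The lower bound on the number of live gates *)

Lemma refute_None n gs o rest cs :
  0 < size rest -> size cs + size rest = 2 ^ n ->
  rest = drop (size cs) (allbits n) ->
  refute gs o (allbits n) rest cs = None ->
  2 * (size rest).-1 + n <= nlive (data_pattern n cs) gs.
Proof.
elim: rest cs => [|a rest IH] cs // _ Hs Hrest Hr.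
have Hg := refute_good Hr Hs.
have Hcs : size cs < size (allbits n) by rewrite size_allbits -Hs /=; lia.
move: Hrest; rewrite (drop_nth [::] Hcs) => -[Ea Erest].
rewrite size_allbits in Hcs; have [Ha Hac] := nth_allbits Hcs.
rewrite -Ea in Ha Hac; have Em : (2 ^ n - size cs).-1 = size rest by move: Hs => /=; lia.
case: (posnP (size rest)) => [E0|Hpos] /=.
  by rewrite E0; apply: nlive_addr Hg; move: Hs => /=; lia.
set c := forcing (wout gs o (stage a cs (size rest))).
have Hr' : refute gs o (allbits n) rest (rcons cs c) = None.
  by move: Hr => /=; case: check => //; case: check.
have Hs' : size (rcons cs c) + size rest = 2 ^ n by rewrite size_rcons -Hs /=; lia.
(* As [rest] is nonempty, the next stage has been tested too. *)
have Hg' : good n gs o (rcons cs c).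
  by case: (rest) Hpos Hr' Hs' => // a' rest' _; apply: refute_good.
have := IH (rcons cs c) Hpos Hs'; rewrite size_rcons => /(_ Erest Hr').
have := @nlive_data_step n gs o a cs; rewrite Em -/c.
have Hlt : (size cs).+1 < 2 ^ n by move: Hs => /=; lia.
by move=> /(_ Ha Hac Hlt Hg Hg'); lia.
Qed.

Lemma refute_size n gs o :
  count (predC is_not) gs < 2 * 2 ^ n + n - 2 ->
  exists a x, [/\ refute gs o (allbits n) (allbits n) [::] = Some (a, x),
    size a = n, size x = 2 ^ n & bout gs o (a ++ x) <> nth false x (addr a)].
Proof.
move=> Hsz; case E: refute => [[a x]|].
  exists a, x; split=> //; by case: (refute_Some E) => //; rewrite size_allbits.
have H2 : 0 < 2 ^ n by rewrite expn_gt0.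
have := refute_None _ _ _ E; rewrite size_allbits drop0 => /(_ H2 (add0n _) erefl).
by have := nlive_size (data_pattern n [::]) gs; lia.
Qed.

(** * The program *)

Definition wcode (x : wval) : nat :=
  match x with
  | Same b => b
  | Con b => 2 + b
  | Diff v None => 4 + v
  | Diff v (Some c) => 6 + 2 * v + c
  end.

Definition wdecode (k : nat) : wval :=
  nth (Same false)
    [:: Same false; Same true; Con false; Con true;
        Diff false None; Diff true None;
        Diff false (Some false); Diff false (Some true);
        Diff true (Some false); Diff true (Some true)] k.

Lemma wcodeK : cancel wcode wdecode.
Proof. by case=> [[]|[]|[] [[]|]]. Qed.

Lemma wcode_le x : wcode x <= 9.
Proof. by case: x => [[]|[]|[] [[]|]]. Qed.

(* So that [enc_wval (Same b)] is [enc_bool b], hence Boolean evaluation is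
   evaluation on [Same] values. *)
Definition enc_wval (x : wval) : tree := enc_nat (wcode x).

Fixpoint econst (t : tree) : expr :=
  if t is Node l r then ENode (econst l) (econst r) else ELeaf.

(* Branches on the unary number in variable v; branch i runs with 2 * i
   additional variables. *)
Fixpoint eswitch (m v : nat) (f : nat -> expr) : expr :=
  if m is m'.+1 then EMatch (EVar v) (f 0) (eswitch m' 1 (fun i => f i.+1))
  else f 0.

Definition etable1 (f : wval -> tree) (v : nat) : expr :=
  eswitch 9 v (fun i => econst (f (wdecode i))).

(** Branch [i] of the outer switch has bound [2 * i] variables, which shifts the index of the second
    operand. *)
Definition etable2 (f : wval -> wval -> wval) (u v : nat) : expr :=
  eswitch 9 u (fun i => eswitch 9 (2 * i + v) (fun j =>
    econst (enc_wval (f (wdecode i) (wdecode j))))).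

(** The program keeps the fixed bits twice, as [Con] values for [stage] and as plain bits for the
    probes; this supplies both encodings. *)
Definition forcing_code (x : wval) : tree :=
  Node (enc_wval (Con (forcing x))) (enc_wval (Same (forcing x))).

(** * The functions of the program *)

(** Call numbers are positions in [refuter]. Several arguments travel as nested pairs, taken apart
    by the outer matches. *)
Definition p_cat : expr :=
  EMatch (EVar 0) ELeaf (EMatch (EVar 0) (EVar 1)
    (ENode (EVar 0) (ECall 1 (ENode (EVar 1) (EVar 3))))).

Definition p_nth : expr :=
  EMatch (EVar 0) ELeaf (EMatch (EVar 0) ELeaf
    (EMatch (EVar 3) (EVar 0) (ECall 2 (ENode (EVar 3) (EVar 1))))).

Definition p_zeros : expr :=
  EMatch (EVar 0) ELeaf (ENode ELeaf (ECall 3 (EVar 1))).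

Definition p_map_cons : expr :=
  EMatch (EVar 0) ELeaf (EMatch (EVar 1) ELeaf
    (ENode (ENode (EVar 2) (EVar 0)) (ECall 4 (ENode (EVar 2) (EVar 1))))).

Definition p_allbits : expr :=
  EMatch (EVar 0) (ENode ELeaf ELeaf) (ELet (ECall 5 (EVar 1))
    (ECall 1 (ENode (ECall 4 (ENode ELeaf (EVar 0)))
                    (ECall 4 (ENode (ENode ELeaf ELeaf) (EVar 0)))))).

Definition p_gate : expr :=
  EMatch (EVar 0) ELeaf (EMatch (EVar 1) ELeaf (EMatch (EVar 0)
    (ELet (ECall 2 (ENode (EVar 2) (EVar 1))) (etable1 (enc_wval \o wnot) 0))
    (EMatch (EVar 3) ELeaf
      (ELet (ECall 2 (ENode (EVar 6) (EVar 0)))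
      (ELet (ECall 2 (ENode (EVar 7) (EVar 2)))
        (EMatch (EVar 5) (etable2 wand 1 0) (etable2 wor 3 2))))))).

Definition p_eval : expr :=
  EMatch (EVar 0) ELeaf (EMatch (EVar 0) (EVar 1)
    (ECall 7 (ENode (EVar 1) (ECall 1 (ENode (EVar 3)
      (ENode (ECall 6 (ENode (EVar 3) (EVar 0))) ELeaf)))))).

Definition p_out : expr :=
  EMatch (EVar 0) ELeaf (EMatch (EVar 0) ELeaf
    (ECall 2 (ENode (ECall 7 (ENode (EVar 0) (EVar 3))) (EVar 1)))).

(** The second [ELet] is the exclusive or of the circuit output and the expected bit, so a leaf
    means agreement. *)
Definition p_check : expr :=
  EMatch (EVar 0) ELeaf (EMatch (EVar 1) ELeaf (EMatch (EVar 1) ELeaf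
  (EMatch (EVar 0) ELeaf (EMatch (EVar 3) ELeaf
  (ELet (ECall 8 (ENode (EVar 8) (ECall 1 (ENode (EVar 2) (EVar 6)))))
  (ELet (EMatch (EVar 0) (EVar 1) (EMatch (EVar 3) (ENode ELeaf ELeaf) ELeaf))
  (EMatch (EVar 0)
    (ECall 9 (ENode (EVar 10) (ENode (EVar 8) (ENode (EVar 5) (EVar 3)))))
    (ENode (EVar 6) (EVar 10))))))))).

Definition p_refute : expr :=
  EMatch (EVar 0) ELeaf (EMatch (EVar 1) ELeaf (EMatch (EVar 1) ELeaf
  (EMatch (EVar 1) ELeaf (EMatch (EVar 2) ELeaf
  (ELet (ECall 3 (EVar 1))
  (ELet (ECall 1 (ENode (EVar 4) (ENode ELeaf (EVar 0))))
  (ELet (ECall 9 (ENode (EVar 10) (ENode (EVar 0) (ENode (EVar 8) (EVar 0)))))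
  (EMatch (EVar 0)
    (ELet (ECall 1 (ENode (EVar 6) (ENode (ENode ELeaf ELeaf) (EVar 2))))
    (ELet (ECall 9 (ENode (EVar 12) (ENode (EVar 0) (ENode (EVar 10) (EVar 0)))))
    (EMatch (EVar 0)
      (ELet (ECall 8 (ENode (EVar 13) (ECall 1 (ENode (EVar 5) (ECall 1
         (ENode (EVar 7) (ENode (econst (enc_wval (Diff false None))) (EVar 4))))))))
      (ELet (etable1 forcing_code 0)
      (EMatch (EVar 0) ELeaf
        (ECall 10 (ENode (EVar 17) (ENode (EVar 15) (ENode (EVar 10)
          (ENode (ECall 1 (ENode (EVar 11) (ENode (EVar 0) ELeaf)))
                 (ECall 1 (ENode (EVar 12) (ENode (EVar 1) ELeaf)))))))))))
      (EVar 2))))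
    (EVar 2))))))))).

Definition p_main : expr :=
  EMatch (EVar 0) ELeaf (ELet (ECall 5 (EVar 0))
    (ECall 10 (ENode (EVar 2) (ENode (EVar 0) (ENode (EVar 0) (ENode ELeaf ELeaf)))))).

Definition refuter : program :=
  [:: p_main; p_cat; p_nth; p_zeros; p_map_cons; p_allbits; p_gate; p_eval;
      p_out; p_check; p_refute].

(** * Correctness and running time of the program *)

(** Costs are bounded from above, so that bounds for subexpressions can be composed and weakened. *)
Definition ev (env : seq tree) (e : expr) (v : tree) (T : nat) : Prop :=
  exists2 t, t <= T & evals refuter env e v t.

Definition fn (f : nat) (x y : tree) (T : nat) : Prop :=
  ev [:: x] (nth ELeaf refuter f) y T.

Lemma ev_wk env e v v' T T' : ev env e v' T' -> v' = v -> T' <= T -> ev env e v T.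
Proof. by move=> [t Ht H] <- HT; exists t => //; exact: leq_trans HT. Qed.

Lemma ev_var_eq env i v : nth Leaf env i = v -> ev env (EVar i) v 1.
Proof. by move=> <-; exists 1 => //; constructor. Qed.

Lemma ev_ELeaf env : ev env ELeaf Leaf 1.
Proof. by exists 1 => //; constructor. Qed.

Lemma ev_ENode env e1 e2 v1 v2 T1 T2 :
  ev env e1 v1 T1 -> ev env e2 v2 T2 ->
  ev env (ENode e1 e2) (Node v1 v2) (T1 + T2).+1.
Proof.
move=> [t1 H1 E1] [t2 H2 E2]; exists (t1 + t2).+1; first by rewrite ltnS leq_add.
exact: ev_node.
Qed.

Lemma ev_match0 env i e0 e1 v T :
  nth Leaf env i = Leaf -> ev env e0 v T -> ev env (EMatch (EVar i) e0 e1) v T.+2.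
Proof.
move=> Hi [t Ht E]; exists (1 + t).+1; first by rewrite !ltnS.
by apply: ev_match_leaf E; rewrite -Hi; constructor.
Qed.

Lemma ev_match1 env i e0 e1 l r v T :
  nth Leaf env i = Node l r -> ev [:: l, r & env] e1 v T ->
  ev env (EMatch (EVar i) e0 e1) v T.+2.
Proof.
move=> Hi [t Ht E]; exists (1 + t).+1; first by rewrite !ltnS.
by apply: ev_match_node E; rewrite -Hi; constructor.
Qed.

Lemma ev_ELet env e1 e2 v1 v T1 T2 :
  ev env e1 v1 T1 -> ev (v1 :: env) e2 v T2 -> ev env (ELet e1 e2) v (T1 + T2).+1.
Proof.
move=> [t1 H1 E1] [t2 H2 E2]; exists (t1 + t2).+1; first by rewrite ltnS leq_add.
exact: ev_let E1 E2.
Qed.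

Lemma ev_ECall env f e v w T1 T2 :
  ev env e v T1 -> fn f v w T2 -> ev env (ECall f e) w (T1 + T2).+1.
Proof.
move=> [t1 H1 E1] [t2 H2 E2]; exists (t1 + t2).+1; first by rewrite ltnS leq_add.
exact: ev_call E1 E2.
Qed.

Fixpoint tree_size (t : tree) : nat :=
  if t is Node l r then (tree_size l + tree_size r).+1 else 1.

Lemma tree_size_enc_nat k : tree_size (enc_nat k) = (2 * k).+1.
Proof. by elim: k => //= k ->; lia. Qed.

Lemma ev_econst env t : ev env (econst t) t (tree_size t).
Proof.
by elim: t => [|l IHl r IHr]; [exact: ev_ELeaf | exact: ev_ENode].
Qed.

(** Each test costs two steps and binds two variables, the predecessor being variable 1. *)
Lemma ev_eswitch m v f env k w T :
  nth Leaf env v = enc_nat k -> k <= m ->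
  (forall env', size env' = 2 * k -> ev (env' ++ env) (f k) w T) ->
  ev env (eswitch m v f) w (T + 2 * m).
Proof.
elim: m v f env k => [|m IHm] v f env [|k] // Hv Hk H.
- by rewrite muln0 addn0; exact: (H [::]).
- apply: (@ev_wk _ _ w _ _ T.+2) => //; last by lia.
  by apply: ev_match0 => //; exact: (H [::]).
- rewrite mulnS addnCA; apply: ev_match1 Hv _.
  apply: (IHm _ _ _ k) => // env' Hs.
  by rewrite -cat_rcons -cat_rcons; apply: H; rewrite !size_rcons Hs; lia.
Qed.

Lemma ev_etable1 f v env x :
  nth Leaf env v = enc_wval x -> ev env (etable1 f v) (f x) (tree_size (f x) + 18).
Proof.
move=> Hv; apply: ev_eswitch Hv (wcode_le x) _ => env' _.
by rewrite wcodeK; exact: ev_econst.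
Qed.

Lemma ev_etable2 f u v env x y :
  nth Leaf env u = enc_wval x -> nth Leaf env v = enc_wval y ->
  ev env (etable2 f u v) (enc_wval (f x y)) 55.
Proof.
move=> Hu Hv; apply: (@ev_wk _ _ _ _ _ (19 + 2 * 9 + 2 * 9)); [|by []|by []].
apply: ev_eswitch Hu (wcode_le x) _ => env' Hs.
apply: (ev_eswitch (k := wcode y)) (wcode_le y) _ => [|env'' Hs'].
  by rewrite nth_cat Hs ltnNge leq_addr addKn.
rewrite !wcodeK; apply: ev_wk (ev_econst _ _) _ _ => //.
by rewrite tree_size_enc_nat; have := wcode_le (f x y); lia.
Qed.

(** * List functions *)

Fixpoint lst (s : seq tree) : tree := if s is x :: s' then Node x (lst s') else Leaf.

Lemma enc_seqE T (enc : T -> tree) s : enc_seq enc s = lst (map enc s).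
Proof. by elim: s => //= x s ->. Qed.

Ltac vred := lazy beta iota zeta delta [nth]; reflexivity.

(** Symbolic execution. It leaves the called functions and the bodies of [ELet] as goals, and values
    and costs as existential variables to be compared at the end through [ev_wk]. *)
Ltac ev0 :=
  lazymatch goal with
  | |- ev _ (EVar _) _ _ => apply: ev_var_eq; vred
  | |- ev _ ELeaf _ _ => exact: ev_ELeaf
  | |- ev _ (ENode _ _) _ _ => eapply ev_ENode; [ev0 | ev0]
  | |- ev _ (ELet _ _) _ _ => eapply ev_ELet; [ev0 | ]
  | |- ev _ (ECall _ _) _ _ => eapply ev_ECall; [ev0 | ]
  | |- ev _ (EMatch _ _ _) _ _ =>
      first [ eapply ev_match0; [vred | ev0] | eapply ev_match1; [vred | ev0] ]
  | |- _ => idtac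
  end.

Ltac ev_start f := rewrite /fn; change (nth ELeaf refuter _) with f; rewrite /f;
  eapply ev_wk.

Lemma fn_cat l1 l2 : fn 1 (Node (lst l1) (lst l2)) (lst (l1 ++ l2)) (20 * size l1 + 20).
Proof.
elim: l1 => [|x l1 IH] /=; ev_start p_cat; ev0; try exact: IH; try reflexivity; lia.
Qed.

Lemma fn_nth l k : fn 2 (Node (lst l) (enc_nat k)) (nth Leaf l k) (20 * size l + 20).
Proof.
by elim: l k => [|x l IH] [|k] /=; ev_start p_nth; ev0;
  try exact: IH; try reflexivity; lia.
Qed.

Lemma fn_zeros l :
  fn 3 (lst l) (lst (map enc_bool (nseq (size l) false))) (20 * size l + 20).
Proof.
by elim: l => [|x l IH] /=; ev_start p_zeros; ev0; try exact: IH; try reflexivity; lia.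
Qed.

Definition enc_bits (s : seq bool) : tree := lst (map enc_bool s).

Lemma fn_map_cons b l :
  fn 4 (Node (enc_bool b) (lst (map enc_bits l)))
    (lst (map enc_bits (map (cons b) l))) (20 * size l + 20).
Proof.
by elim: l => [|x l IH] /=; ev_start p_map_cons; ev0; try exact: IH; try reflexivity; lia.
Qed.

Lemma fn_allbits n : fn 5 (enc_nat n) (lst (map enc_bits (allbits n))) (200 * 2 ^ n).
Proof.
elim: n => [|n IH] /=; ev_start p_allbits; ev0; try exact: IH.
- by [].
- by [].
- ev0; [exact: (fn_map_cons false) | exact: (fn_map_cons true) | exact: fn_cat].
- by rewrite map_cat.
- by rewrite !size_map size_allbits expnS; have := expn_gt0 2 n; lia.
Qed.

(** * The circuit evaluator *)

Definition enc_wires (ws : seq wval) : tree := lst (map enc_wval ws).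

(** The default [Leaf] of tree lookup is the encoding of [Same false]. *)
Lemma fn_nth_wires ws k :
  fn 2 (Node (enc_wires ws) (enc_nat k)) (enc_wval (nth (Same false) ws k))
    (20 * size ws + 20).
Proof.
by have := fn_nth (map enc_wval ws) k; rewrite (nth_map_dflt _ (Same false)) size_map.
Qed.

Lemma tree_size_enc_wval x : tree_size (enc_wval x) <= 19.
Proof. by rewrite tree_size_enc_nat; have := wcode_le x; lia. Qed.

Lemma fn_gate ws g :
  fn 6 (Node (enc_wires ws) (enc_gate g)) (enc_wval (wgate ws g)) (40 * size ws + 200).
Proof.
case: g => [i|i j|i j]; ev_start p_gate; ev0; try exact: fn_nth_wires.
- exact: ev_etable1.
- by [].
- by have := tree_size_enc_wval (wnot (nth (Same false) ws i)); rewrite /=; lia.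
- ev0; first exact: fn_nth_wires.
  by ev0; exact: ev_etable2.
- by [].
- lia.
- ev0; first exact: fn_nth_wires.
  by ev0; exact: ev_etable2.
- by [].
- lia.
Qed.

Lemma enc_wires_rcons ws x :
  lst (map enc_wval ws ++ [:: enc_wval x]) = enc_wires (rcons ws x).
Proof. by rewrite /enc_wires map_rcons cats1. Qed.

Lemma size_weval ws gs : size (weval ws gs) = size ws + size gs.
Proof.
elim: gs ws => [|g gs IH] ws; first by rewrite addn0.
by rewrite /weval /gen_eval /= [LHS]IH size_rcons addSnnS.
Qed.

(** [W] bounds the final number of wires, so it stays valid while [ws] grows. *)
Lemma fn_eval gs ws W : size ws + size gs <= W ->
  fn 7 (Node (lst (map enc_gate gs)) (enc_wires ws)) (enc_wires (weval ws gs))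
    (size gs * (60 * W + 300) + 20).
Proof.
elim: gs ws => [|g gs IH] ws HW; ev_start p_eval; ev0.
- by [].
- by [].
- exact: fn_gate.
- exact: (fn_cat _ [:: _]).
- by rewrite enc_wires_rcons; apply: IH; rewrite size_rcons addSnnS.
- by [].
- by rewrite size_map /= mulSn; move: HW => /=; lia.
Qed.

Definition enc_net (gs : seq gate) (o : nat) : tree :=
  Node (lst (map enc_gate gs)) (enc_nat o).

Lemma fn_out gs o ws W : size ws + size gs <= W ->
  fn 8 (Node (enc_net gs o) (enc_wires ws)) (enc_wval (wout gs o ws))
    (200 * (W.+1 * W.+1)).
Proof.
move=> HW; ev_start p_out; ev0.
- exact: fn_eval HW.
- exact: fn_nth_wires.
- by [].
- rewrite size_weval.
  have : size gs * (60 * W + 300) <= W * (60 * W + 300).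
    by rewrite leq_mul2r; apply/orP; right; lia.
  by rewrite !(mulSn, mulnS, mulnDr); lia.
Qed.

(** * The tests and the refutation loop *)

Definition enc_result (r : option (seq bool * seq bool)) : tree :=
  if r is Some (a, d) then Node (enc_bits a) (enc_bits d) else Leaf.

Lemma enc_bits_wires s : enc_bits s = enc_wires (map Same s).
Proof. by rewrite /enc_wires -map_comp; congr lst; apply: eq_map; case. Qed.

Lemma fn_check gs o d addrs ds (n W : nat) :
  all (fun a => size a == n) addrs -> n + size d + size gs <= W ->
  fn 9 (Node (enc_net gs o) (Node (enc_bits d)
         (Node (lst (map enc_bits addrs)) (enc_bits ds))))
    (enc_result (check gs o d addrs ds))
    (size addrs * (300 * (W.+1 * W.+1)) + 100).
Proof.
move=> + HW; elim: addrs ds => [|a addrs IH] [|x ds] /=;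
  try by move=> _; ev_start p_check; ev0; [|rewrite addnC].
case/andP=> /eqP Ha Hall.
have Hout : fn 8 (Node (enc_net gs o) (lst (map enc_bool a ++ map enc_bool d)))
    (enc_bool (bout gs o (a ++ d))) (200 * (W.+1 * W.+1)).
  rewrite -map_cat -/(enc_bits _) enc_bits_wires.
  have -> : enc_bool (bout gs o (a ++ d)) = enc_wval (wout gs o (map Same (a ++ d))).
    by rewrite wout_same; case: bout.
  by apply: fn_out; rewrite size_map size_cat Ha.
ev_start p_check; ev0.
- exact: (fn_cat (map enc_bool a) (map enc_bool d)).
- exact: Hout.
- eapply ev_ELet.
  + apply: (@ev_wk _ _ (enc_bool (bout gs o (a ++ d) != x)) _ _ 7);
      [|reflexivity|exact: leqnn].
    case: (bout gs o (a ++ d)) x => [] []; eapply ev_wk;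
      first [by ev0|by []].
  (* Value and cost are given before the case split, since both outcomes must share them. *)
  + instantiate (1 := (size addrs * (300 * (W.+1 * W.+1)) + 120)).
    instantiate (1 := enc_result
      (if bout gs o (a ++ d) == x then check gs o d addrs ds else Some (a, d))).
    case: eqP => _.
    * eapply ev_wk; ev0; [exact: (IH ds Hall)|reflexivity|].
      by move: (size addrs * _) => K; lia.
    * by eapply ev_wk; ev0; [|rewrite addnC].
- by [].
- rewrite size_map Ha (mulSn (size addrs)).
  have : W.+1 <= W.+1 * W.+1 by rewrite leq_pmulr.
  by move: (W.+1 * W.+1) => V; move: (size addrs * _) => K; lia.
Qed.

(** A stage makes two checks of at most [W] evaluations, each quadratic in [W], hence the cubic cost
    per stage. *)
Lemma fn_refute gs o addrs rest cs (n W : nat) :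
  all (fun a => size a == n) addrs -> all (fun a => size a == n) rest ->
  size addrs <= W -> n + (size cs + size rest) + size gs <= W ->
  fn 10 (Node (enc_net gs o) (Node (lst (map enc_bits addrs))
      (Node (lst (map enc_bits rest))
        (Node (enc_wires (map Con cs)) (enc_bits cs)))))
    (enc_result (refute gs o addrs rest cs))
    (size rest * (2500 * (W.+1 * W.+1 * W.+1)) + 100).
Proof.
move=> Haddrs + HN; elim: rest cs => [|a rest IH] cs /=.
  by move=> _ _; ev_start p_refute; ev0; [|rewrite addnC].
case/andP=> /eqP Ha Hrest HW.
have Hcheck b : fn 9 (Node (enc_net gs o) (Node (enc_bits (probe cs b (size rest)))
         (Node (lst (map enc_bits addrs)) (enc_bits (probe cs b (size rest))))))
    (enc_result (check gs o (probe cs b (size rest)) addrs (probe cs b (size rest))))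
    (size addrs * (300 * (W.+1 * W.+1)) + 100).
  by apply: (@fn_check gs o _ addrs _ n W) => //; rewrite size_probe.
have Hprobe b : enc_bits (probe cs b (size rest)) = lst (map enc_bool cs ++
    enc_bool b :: map enc_bool (nseq (size rest) false)).
  by rewrite /enc_bits map_cat.
have Hstage : enc_wires (stage a cs (size rest)) = lst (map enc_bool a ++
   (map enc_wval (map Con cs) ++ enc_wval (Diff false None) ::
     map enc_bool (nseq (size rest) false))).
  rewrite /enc_wires /stage !map_cat /= -!(map_comp _ Same).
  by congr (lst (_ ++ (_ ++ _ :: _))); apply: eq_map; case.
have Hout : fn 8 (Node (enc_net gs o) (enc_wires (stage a cs (size rest))))
    (enc_wval (wout gs o (stage a cs (size rest)))) (200 * (W.+1 * W.+1)).
  apply: fn_out; rewrite /stage !size_cat /= !size_map size_nseq Ha; lia.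
rewrite Hstage in Hout; move: Hcheck.
have := Hprobe false; have := Hprobe true.
set p1 := probe cs true _; set p0 := probe cs false _ => H1 H0 Hcheck.
have := Hcheck false; have {Hcheck} := Hcheck true; rewrite -/p1 -/p0.
(* The results of the two checks become variables, so that case analysis selects the branch both in
   [refute] and in the program. *)
rewrite H1 H0; move: (check gs o p0 addrs p0) (check gs o p1 addrs p1) => r0 r1.
move=> Hc1 Hc0 {Hprobe Hstage H0 H1 p0 p1}.
have Hz : fn 3 (lst (map enc_bits rest)) (lst (map enc_bool (nseq (size rest) false)))
    (20 * size rest + 20).
  by have := fn_zeros (map enc_bits rest); rewrite size_map.
set c := forcing _.
have Hk : fn 1 (Node (enc_wires (map Con cs)) (Node (enc_wval (Con c)) Leaf))
    (enc_wires (map Con (rcons cs c))) (20 * size cs + 20).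
  have := fn_cat (map enc_wval (map Con cs)) [:: enc_wval (Con c)].
  by rewrite /enc_wires !map_rcons cats1 !size_map.
have Hb : fn 1 (Node (enc_bits cs) (Node (enc_wval (Same c)) Leaf))
    (enc_bits (rcons cs c)) (20 * size cs + 20).
  have := fn_cat (map enc_bool cs) [:: enc_bool c].
  by rewrite /enc_bits !map_rcons cats1 !size_map; case: (c).
have Hrec : fn 10 (Node (enc_net gs o) (Node (lst (map enc_bits addrs))
      (Node (lst (map enc_bits rest))
        (Node (enc_wires (map Con (rcons cs c))) (enc_bits (rcons cs c))))))
    (enc_result (refute gs o addrs rest (rcons cs c)))
    (size rest * (2500 * (W.+1 * W.+1 * W.+1)) + 100).
  by apply: IH => //; rewrite size_rcons addSnnS.
have le_UV : W.+1 <= W.+1 * W.+1 by rewrite leq_pmulr.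
have le_VT : W.+1 * W.+1 <= W.+1 * W.+1 * W.+1 by rewrite leq_pmulr.
have le_CT : size addrs * (300 * (W.+1 * W.+1)) <= 300 * (W.+1 * W.+1 * W.+1).
  by rewrite mulnCA leq_mul2l /= [leqRHS]mulnC leq_mul2r; apply/orP; right; apply: leqW.
have le_cs : size cs <= W by lia.
have le_rest : size rest <= W by lia.
have le_n : n <= W by lia.
rewrite (mulSn (size rest)).
move: (fn_cat (map enc_bool cs)
  (enc_bool false :: map enc_bool (nseq (size rest) false))) => Hcat0.
move: (fn_cat (map enc_bool cs)
  (enc_bool true :: map enc_bool (nseq (size rest) false))) => Hcat1.
move: (fn_cat (map enc_wval (map Con cs)) (enc_wval (Diff false None) ::
  map enc_bool (nseq (size rest) false))) => HcatK.
move: (fn_cat (map enc_bool a) (map enc_wval (map Con cs) ++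
  enc_wval (Diff false None) :: map enc_bool (nseq (size rest) false))) => HcatA.
rewrite !size_map in Hcat0 Hcat1 HcatK HcatA; rewrite Ha in HcatA.
case: r0 Hc0 => [[a0 d0]|] Hc0 /=.
  ev_start p_refute; ev0; first exact: Hz.
  - ev0; first exact: Hcat0.
    ev0; first exact: Hc0.
    by ev0.
  - by [].
  (* Naming the products leaves a linear goal. *)
  - move: (size addrs * _) (size rest * _) le_CT => C R; lia.
case: r1 Hc1 => [[a1 d1]|] Hc1 /=.
  ev_start p_refute; ev0; first exact: Hz.
  - ev0; first exact: Hcat0.
    ev0; first exact: Hc0.
    ev0; first exact: Hcat1.
    ev0; first exact: Hc1.
    by ev0.
  - by [].
  - move: (size addrs * _) (size rest * _) le_CT => C R; lia.
ev_start p_refute; ev0; first exact: Hz.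
- ev0; first exact: Hcat0.
  ev0; first exact: Hc0.
  ev0; first exact: Hcat1.
  ev0; first exact: Hc1.
  ev0.
  + exact: ev_econst.
  + exact: HcatK.
  + exact: HcatA.
  + exact: Hout.
  + eapply ev_ELet; first exact: ev_etable1.
    ev0; [exact: Hk|exact: Hb|exact: Hrec].
- by [].
- rewrite /forcing_code /=.
  have := tree_size_enc_wval (Con c); have := tree_size_enc_wval (Same c).
  rewrite -/c.
  move: (tree_size (enc_wval (Con c))) (tree_size (enc_wval (Same c))) => s1 s2.
  move: (size addrs * _) (size rest * _) le_CT => C R; lia.
Qed.

(** * The whole program *)

Lemma fn_main n gs o :
  fn 0 (Node (enc_nat n) (enc_net gs o))
    (enc_result (refute gs o (allbits n) (allbits n) [::]))
    (3000 * (n + 2 ^ n + size gs).+1 ^ 4).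
Proof.
set W := n + 2 ^ n + size gs.
have Hall : all (fun a => size a == n) (allbits n).
  apply/(all_nthP [::]) => k; rewrite size_allbits => Hk.
  by have [-> _] := nth_allbits Hk.
have Hr := @fn_refute gs o (allbits n) (allbits n) [::] n W Hall Hall.
rewrite size_allbits /= add0n in Hr.
have {}Hr := Hr ltac:(rewrite /W; lia) (leqnn W).
ev_start p_main; ev0.
- exact: fn_allbits.
- by ev0; exact: Hr.
- by [].
- have H1 : 2 ^ n <= W.+1 by rewrite /W; lia.
  have H2 : 2 ^ n * (2500 * (W.+1 * W.+1 * W.+1)) <= 2500 * W.+1 ^ 4.
    by rewrite mulnCA leq_mul2l /= !expnS expn0 muln1 -!mulnA leq_mul2r H1 orbT.
  have H3 : W.+1 <= W.+1 ^ 4 by rewrite -{1}[W.+1]expn1 leq_pexp2l.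
  move: (_ * (2500 * _)) (W.+1 ^ 4) H2 H3 => A B; lia.
Qed.

Theorem theorem13 :
  exists (P : program) (c k : nat),
    forall n : nat, 1 <= n ->
    forall C : circuit (n + 2 ^ n),
      circ_size C < 2 * 2 ^ n + n - 2 ->
      exists (alpha : n.-tuple bool) (rho : (2 ^ n).-tuple bool) (t : nat),
        [/\ runs P (enc_instance C) (enc_input alpha rho) t,
            t <= c * (2 ^ n + circ_nots C) ^ k
          & circ_eval C (cat_tuple alpha rho) <> MUX alpha rho].
Proof.
(* With N = 2 ^ n, n < N and fewer than 2 N + n - 2 binary gates, inputs and gates plus one number
   at most 5 N plus the NOT gates. The fourth power comes from N stages of cubic cost. *)
exists refuter, (3000 * 5 ^ 4), 4 => n n_gt0 C ltC.
have [a [x [Er Ha Hx Hne]]] := refute_size (circ_out C) ltC.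
have [t Ht Hrun] := fn_main n (circ_gates C) (circ_out C).
exists (Tuple (introT eqP Ha)), (Tuple (introT eqP Hx)), t; split.
- move: Hrun; rewrite Er /runs /enc_instance /enc_circuit /enc_input /enc_net.
  by rewrite !enc_seqE.
- apply: leq_trans Ht _; rewrite -mulnA leq_mul2l -expnMn leq_exp2r //.
  have -> : size (circ_gates C) = circ_size C + circ_nots C.
    by rewrite -(count_predC is_not (circ_gates C)); apply: addnC.
  by have := ltn_expl n (ltnSn 1); lia.
- by rewrite circ_evalE /MUX (tnth_nth false).
Qed.
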